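(* Let $J=\{J_0,\dots,J_s\}$ be a list of finite subsets $J_p\subset G$, and suppose subsets $\mathcal{V}^i_B(S)\subseteq\mathcal{Z}^i_B(S)$ are given for all $i\ge0$. Suppose that the $G$-graded $S$-module $M$ has a resolution of type $J$. Then for each $i\ge0$ $$\mathcal{D}^i_B(J)\subseteq\mathcal{Z}^i_B(M).$$
   Context: $K$ is a field, $G$ is a finitely generated abelian group, $S=K[x_1,\dots,x_n]$ is a $G$-graded polynomial $K$-algebra, and $B\subset S$ is a $G$-graded ideal. For a $G$-graded $S$-module $M$, $H^i_B(M)$ is the $G$-graded local cohomology and $\mathcal{Z}^i_B(M)=\{\mathbf{p}\in G:H^i_B(M)_{\mathbf{p}}=0\}$. $S(\mathbf{d})_{\mathbf{e}}=S_{\mathbf{d}+\mathbf{e}}$. A resolution of type $J$ of $M$ is an exact sequence of $G$-graded modules with degree-preserving maps $$0\to\bigoplus_{\mathbf{d}_s\in J_s}S(-\mathbf{d}_s)\to\cdots\to\bigoplus_{\mathbf{d}_0\in J_0}S(-\mathbf{d}_0)\to M\to0,$$ where finite repetition of each summand $S(-\mathbf{d}_p)$ is allowed. Given the regions $\mathcal{V}^i_B(S)\subseteq\mathcal{Z}^i_B(S)$, $$\mathcal{D}^i_B(J)=\bigcap_{p=0}^s\bigcap_{\mathbf{d}_p\in J_p}\bigl(\mathbf{d}_p+\mathcal{V}^{i+p}_B(S)\bigr).$$ *)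

(* Defs.v *)
From HB Require Import structures.
From mathcomp Require Import all_boot all_order all_algebra finmap.
From mathcomp Require Import mpoly.
From mathcomp Require Import boolp classical_sets.

Set Implicit Arguments.
Unset Strict Implicit.
Unset Printing Implicit Defensive.

Import GRing.Theory.
Local Open Scope ring_scope.
Local Open Scope classical_set_scope.

Definition fin_gen_group (G : zmodType) : Prop :=
  exists gs : seq G, forall g : G, exists c : G -> int,
    g = \sum_(h <- gs) h *~ c h.

(* A G-grading of the K-algebra S = K[x_1, .., x_n] (K in degree 0, variables
   homogeneous) is given by the degrees w i of the variables. *)
Section Grading.
Variables (K : fieldType) (G : zmodType) (n : nat) (w : 'I_n -> G).
Local Notation S := {mpoly K[n]}.

Definition wdeg (m : 'X_{1..n}) : G := \sum_(i < n) w i *+ m i.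

(* The graded piece S_g. *)
Definition homogS (g : G) : set S :=
  [set f | forall m, m \in msupp f -> wdeg m = g].

Definition hcompS (g : G) (f : S) : S :=
  \sum_(m <- msupp f | wdeg m == g) f@_m *: 'X_[m].

(* A G-graded S-module: gr_span and gr_direct say that it is the direct sum of
   the subgroups gr g. *)
Record gmod := GMod {
  gcarrier :> lmodType S;
  gr : G -> set gcarrier;
  gr0 : forall g, gr g 0;
  grB : forall g x y, gr g x -> gr g y -> gr g (x - y);
  grZ : forall d e a x, homogS d a -> gr e x -> gr (d + e) (a *: x);
  gr_span : forall x, exists s : seq gcarrier,
    (forall y, y \in s -> exists g, gr g y) /\ x = \sum_(y <- s) y;
  gr_direct : forall (s : seq G) (c : G -> gcarrier), uniq s ->
    (forall g, gr g (c g)) -> \sum_(g <- s) c g = 0 ->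
    forall g, g \in s -> c g = 0 }.

Record ghom (M N : gmod) := GHom {
  gfun :> {linear M -> N};
  ghom_deg : forall g x, gr g x -> gr g (gfun x) }.

Lemma homogS0 g : homogS g 0.
Proof. by move=> m; rewrite msupp0. Qed.

Lemma homogSB g x y : homogS g x -> homogS g y -> homogS g (x - y).
Proof.
move=> hx hy m /msuppB_le; rewrite mem_cat => /orP[]; [exact: hx|exact: hy].
Qed.

Lemma wdegD m1 m2 : wdeg (m1 + m2)%MM = wdeg m1 + wdeg m2.
Proof.
by rewrite /wdeg -big_split; apply: eq_bigr => i _; rewrite mnmDE mulrnDr.
Qed.

Lemma homogSM d e (a : S) (x : S^o) :
  homogS d a -> homogS e x -> homogS (d + e) (a *: x).
Proof.
move=> ha hx m /msuppM_le /allpairsP[[m1 m2] /= [h1 h2 ->]].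
by rewrite wdegD (ha _ h1) (hx _ h2).
Qed.

Lemma homogS_span (x : S^o) : exists s : seq S^o,
  (forall y, y \in s -> exists g, homogS g y) /\ x = \sum_(y <- s) y.
Proof.
exists [seq (x : S)@_m *: 'X_[m] | m <- msupp (x : S)]; split; last first.
  by rewrite big_map; exact: mpolyE.
move=> _ /mapP[m hm ->]; exists (wdeg m) => m'.
by move=> /msuppZ_le; rewrite msuppX inE => /eqP ->.
Qed.

Lemma homogS_direct (s : seq G) (c : G -> S^o) : uniq s ->
  (forall g, homogS g (c g)) -> \sum_(g <- s) c g = 0 ->
  forall g, g \in s -> c g = 0.
Proof.
move=> us hc s0 g gs; apply/mpolyP => m; rewrite mcoeff0.
case: (boolP (m \in msupp (c g : S))) => [hm|/memN_msupp_eq0 //].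
have := congr1 (mcoeff m) (s0 : \sum_(g <- s) (c g : S) = 0).
rewrite mcoeff0 raddf_sum /= (bigD1_seq g) //= big1 ?addr0 // => h hg.
apply/memN_msupp_eq0/negP => hm'.
by case/eqP: hg; rewrite -(hc h m hm') (hc g m hm).
Qed.

Definition Smod : gmod :=
  @GMod S^o homogS homogS0 homogSB homogSM homogS_span homogS_direct.

Section Shift.
Variables (M : gmod) (d : G).

(* M(d)_e = M_(d + e). *)
Definition shift_gr (e : G) : set M := gr (d + e).

Lemma shift_gr0 g : shift_gr g 0. Proof. exact: gr0. Qed.

Lemma shift_grB g x y : shift_gr g x -> shift_gr g y -> shift_gr g (x - y).
Proof. exact: grB. Qed.

Lemma shift_grZ b e a x :
  homogS b a -> shift_gr e x -> shift_gr (b + e) (a *: x).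
Proof. by rewrite /shift_gr addrCA; exact: grZ. Qed.

Lemma shift_gr_span (x : M) : exists s : seq M,
  (forall y, y \in s -> exists g, shift_gr g y) /\ x = \sum_(y <- s) y.
Proof.
have [s [hs ->]] := gr_span x; exists s; split=> // y /hs[g hg].
by exists (g - d); rewrite /shift_gr addrC subrK.
Qed.

Lemma shift_gr_direct (s : seq G) (c : G -> M) : uniq s ->
  (forall g, shift_gr g (c g)) -> \sum_(g <- s) c g = 0 ->
  forall g, g \in s -> c g = 0.
Proof.
move=> us hc s0 g gs.
have := @gr_direct M [seq d + h | h <- s] (fun h => c (h - d)).
rewrite map_inj_uniq; last exact: addrI.
move=> /(_ us) H; have -> : g = (d + g) - d by rewrite addrC addKr.
apply: H; last by rewrite map_f.
  by move=> h; have := hc (h - d); rewrite /shift_gr addrC subrK.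
rewrite big_map -[RHS]s0; apply: eq_bigr => h _.
by rewrite [d + h]addrC addrK.
Qed.

Definition shift : gmod :=
  @GMod M shift_gr shift_gr0 shift_grB shift_grZ shift_gr_span shift_gr_direct.

End Shift.

Section ShiftSum.
Variables (M : gmod) (I : finType) (d : I -> G).
Local Notation T := {ffun I -> M}.

Definition shift_sum_gr (e : G) : set T :=
  [set F | forall i, @gr (shift M (d i)) e (F i)].

Lemma shift_sum_gr0 g : shift_sum_gr g 0.
Proof. by move=> i; rewrite ffunE; exact: gr0. Qed.

Lemma shift_sum_grB g x y :
  shift_sum_gr g x -> shift_sum_gr g y -> shift_sum_gr g (x - y).
Proof.
move=> hx hy i; rewrite !ffunE.
exact: (@grB (shift M (d i)) _ _ _ (hx i) (hy i)).
Qed.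

Lemma shift_sum_grZ b e a x :
  homogS b a -> shift_sum_gr e x -> shift_sum_gr (b + e) (a *: x).
Proof.
by move=> ha hx i; rewrite ffunE; exact: (@grZ (shift M (d i)) _ _ _ _ ha (hx i)).
Qed.

Lemma shift_sum_gr_span (x : T) : exists s : seq T,
  (forall y, y \in s -> exists g, shift_sum_gr g y) /\ x = \sum_(y <- s) y.
Proof.
pose P (x : T) := exists s : seq T,
  (forall y, y \in s -> exists g, shift_sum_gr g y) /\ x = \sum_(y <- s) y.
have P0 : P 0 by exists [::]; split=> //; rewrite big_nil.
have PD y z : P y -> P z -> P (y + z).
  move=> [s [hs ->]] [t [ht ->]]; exists (s ++ t); rewrite big_cat; split=> // u.
  by rewrite mem_cat => /orP[/hs|/ht].
pose dl i (m : M) : T := [ffun j => if j == i then m else 0].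
have Pdl i m : P (dl i m).
  have [s [hs ->]] := @gr_span (shift M (d i)) m.
  exists [seq dl i y | y <- s]; split.
    move=> _ /mapP[y /hs[g hg] ->]; exists g => j; rewrite ffunE.
    by case: eqP => [->//|_]; exact: gr0.
  rewrite big_map; apply/ffunP => j; rewrite sum_ffunE ffunE.
  case: eqP => [->|/eqP ji]; first by apply: eq_bigr => y _; rewrite ffunE eqxx.
  by rewrite big1 // => y _; rewrite ffunE (negPf ji).
suff -> : x = \sum_i dl i (x i) by apply: (big_ind P) => // i _; exact: Pdl.
apply/ffunP => j; rewrite sum_ffunE (bigD1 j) //= ffunE eqxx big1 ?addr0 // => i.
by rewrite ffunE eq_sym => /negPf ->.
Qed.

Lemma shift_sum_gr_direct (s : seq G) (c : G -> T) : uniq s ->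
  (forall g, shift_sum_gr g (c g)) -> \sum_(g <- s) c g = 0 ->
  forall g, g \in s -> c g = 0.
Proof.
move=> us hc s0 g gs; apply/ffunP => i; rewrite ffunE.
apply: (@gr_direct (shift M (d i)) s (fun h => c h i) us _ _ g gs).
  by move=> h; exact: hc.
by have := congr1 (fun F : T => F i) s0; rewrite sum_ffunE ffunE.
Qed.

(* The direct sum of the shifted modules M(d i), for i in I. *)
Definition shift_sum : gmod :=
  @GMod T shift_sum_gr shift_sum_gr0 shift_sum_grB shift_sum_grZ
    shift_sum_gr_span shift_sum_gr_direct.

End ShiftSum.

Definition graded_ideal (B : set S) : Prop :=
  [/\ B 0, (forall x y, B x -> B y -> B (x + y)),
      (forall a x, B x -> B (a * x)) & (forall g x, B x -> B (hcompS g x))].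

Definition ideal_mul (A B : set S) : set S :=
  [set f | exists s : seq (S * S),
     (forall u, u \in s -> A u.1 /\ B u.2) /\ f = \sum_(u <- s) u.1 * u.2].

Definition ideal_pow (B : set S) (t : nat) : set S :=
  iter t (ideal_mul B) setT.

(* Gamma_B(M) = H^0_B(M): the elements killed by some power of B. *)
Definition torsion (B : set S) (M : gmod) : set M :=
  [set x | exists t, forall f, ideal_pow B t f -> f *: x = 0].

(* Injective object in the category of G-graded S-modules and degree-preserving
   maps. *)
Definition ginjective (Q : gmod) : Prop :=
  forall (A C : gmod) (u : ghom A C) (v : ghom A Q), injective u ->
    exists h : ghom C Q, forall x, h (u x) = v x.

(* 0 -> M -> I^0 -> I^1 -> ... *)
Record injres (M : gmod) := InjRes {
  ir_mod : nat -> gmod;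
  ir_aug : ghom M (ir_mod 0);
  ir_d : forall i, ghom (ir_mod i) (ir_mod i.+1);
  ir_inj : forall i, ginjective (ir_mod i);
  ir_aug_inj : injective ir_aug;
  ir_exact0 : forall x, ir_d 0 x = 0 <-> exists y, ir_aug y = x;
  ir_exact : forall i x, ir_d i.+1 x = 0 <-> exists y, ir_d i y = x }.

(* Degree p cocycles and coboundaries of the complex Gamma_B(I), whose i-th
   cohomology is H^i_B(M). *)
Definition lc_cocycles (B : set S) (M : gmod) (I : injres M) (i : nat) (p : G) :
    set (ir_mod I i) :=
  [set z | [/\ torsion B z, gr p z & ir_d I i z = 0]].

Definition lc_coboundaries (B : set S) (M : gmod) (I : injres M) (i : nat)
    (p : G) : set (ir_mod I i) :=
  match i with
  | 0 => [set 0]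
  | j.+1 => [set ir_d I j y | y in [set y | torsion B y /\ gr p y]]
  end.

(* {p | H^i_B(M)_p = 0}, with H^i_B the i-th right derived functor of Gamma_B.
   The cohomology does not depend on the injective resolution; with the
   existential, membership of p cannot hold for want of a resolution. *)
Definition lc_zero (B : set S) (i : nat) (M : gmod) : set G :=
  [set p | exists I : injres M,
     @lc_cocycles B M I i p = @lc_coboundaries B M I i p].

(* The sum of the S(-d), d in J, with S(-d) repeated mult d times. *)
Definition free_of_type (J : {fset G}) (mult : G -> nat) : gmod :=
  @shift_sum Smod {d : J & 'I_(mult (val d))} (fun j => - val (tag j)).

(* Since nth returns the empty set beyond the end of J, the p-th module F p is
   zero for p >= size J: the exact sequence indexed by nat below is the finite
   one, including injectivity of its leftmost map. *)
Definition has_resolution_of_type (J : seq {fset G}) (M : gmod) : Prop :=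
  exists mult : nat -> G -> nat,
    let F p := free_of_type (nth fset0 J p) (mult p) in
    (forall p d, d \in nth fset0 J p -> (0 < mult p d)%N) /\
    exists (aug : ghom (F 0%N) M) (del : forall p, ghom (F p.+1) (F p)),
      [/\ forall x, exists y, aug y = x,
          forall y, aug y = 0 <-> exists z, del 0%N z = y
        & forall p y, del p y = 0 <-> exists z, del p.+1 z = y].

Definition typeD (s : nat) (V : nat -> set G) (J : s.+1.-tuple {fset G})
    (i : nat) : set G :=
  \bigcap_(p in [set: 'I_s.+1])
    \bigcap_(d in [set d | d \in tnth J p]) [set d + v | v in V (i + p)%N].

End Grading.

(* Main.v *)
From HB Require Import structures.
Require Import Defs.
From mathcomp Require Import all_boot all_order all_algebra finmap.
From mathcomp Require Import mpoly.
From mathcomp Require Import boolp classical_sets.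

(* For a surjection f : N -> M, the vanishing of H^i_B(N)_p and of
   H^(i+1)_B(ker f)_p forces that of H^i_B(M)_p; peeling off the modules of the
   resolution one at a time reduces the claim to the free modules S(-d).
   No existence theorem for injective resolutions is needed: resolutions of N
   and ker f yield one of M, namely the cone of a lift of the inclusion of ker f,
   whose leftmost map I^0(ker f) -> cone^0 is injective, hence split, so that it
   can be divided out.  Vanishing does not depend on the injective resolution, so
   a single resolution of S serves for all the summands S(-d) at once. *)

Set Implicit Arguments.
Unset Strict Implicit.
Unset Printing Implicit Defensive.

Import GRing.Theory.
Local Open Scope ring_scope.
Local Open Scope classical_set_scope.

(** * Homogeneous components and maps of graded modules *)

Section GradedModules.
Variables (K : fieldType) (G : zmodType) (n : nat) (w : 'I_n -> G).
Local Notation S := {mpoly K[n]}.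
Local Notation gmod := (gmod K w).
Implicit Types (M N L Q : gmod) (g : G).

Definition ghom_of M N (f : M -> N) (lin_f : linear f)
    (deg_f : forall g x, gr g x -> gr g (f x)) : ghom M N :=
  @GHom K G n w M N
    (HB.pack_for {linear M -> N} f (GRing.isLinear.Build S M N *:%R f lin_f))
    deg_f.

Lemma grN M g (x : M) : gr g x -> gr g (- x).
Proof. by move=> gx; rewrite -sub0r; apply: grB => //; exact: gr0. Qed.

Lemma grD M g (x y : M) : gr g x -> gr g y -> gr g (x + y).
Proof. by move=> gx gy; rewrite -[y]opprK; apply: grB => //; exact: grN. Qed.

(** Collecting homogeneous summands of equal degree leaves one component per degree, the form that
    [gr_direct] applies to. The degree [g0] is forced into [s] so that its component can be named
    even when it is zero. *)
Lemma gr_decomp M g0 (x : M) : exists (s : seq G) (c : G -> M),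
  [/\ uniq s, g0 \in s, forall g, gr g (c g) & x = \sum_(g <- s) c g].
Proof.
have [t [ht ->]] := gr_span x; elim: t ht => [|y t IH] ht.
  exists [:: g0], (fun=> 0); split=> [//||g|]; first exact: mem_head.
    exact: gr0.
  by rewrite big_nil big1.
have [z zt|s [c [us g0s hc ts]]] := IH; first by apply: ht; rewrite inE zt orbT.
have [g gy] := ht y (mem_head y t).
pose c' h := (if h \in s then c h else 0) + (if h == g then y else 0).
have gs : g \in undup (g :: s) by rewrite mem_undup mem_head.
exists (undup (g :: s)), c'; split.
- exact: undup_uniq.
- by rewrite mem_undup inE g0s orbT.
- move=> h; apply: grD; first by case: ifP => _ //; exact: gr0.
  by case: eqP => [->//|_]; exact: gr0.
rewrite big_cons ts [LHS]addrC /c' big_split; congr (_ + _).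
  rewrite -big_mkcond -[RHS]big_filter; apply: perm_big; apply: uniq_perm => //.
    by rewrite filter_uniq // undup_uniq.
  move=> h; rewrite mem_filter mem_undup inE.
  by case: (h \in s); rewrite ?orbT.
rewrite (bigD1_seq g gs (undup_uniq _)) /= eqxx big1 ?addr0 // => h.
by move=> /negPf ->.
Qed.

(** Subtracting [y] in degree [g] turns the sum into a vanishing one, to which [gr_direct]
    applies. *)
Lemma gr_sum_comp M (s : seq G) (c : G -> M) g y : uniq s -> g \in s ->
  (forall h, gr h (c h)) -> gr g y -> \sum_(h <- s) c h = y -> c g = y.
Proof.
move=> us gs hc gy sy; apply/eqP; rewrite -subr_eq0; apply/eqP.
have := @gr_direct _ _ _ _ M s (fun h => c h - (if h == g then y else 0)) us.
move=> /(_ _ _ g gs); rewrite eqxx; apply.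
  by move=> h; apply: grB => //; case: eqP => [->//|_]; exact: gr0.
rewrite sumrB sy (bigD1_seq g gs us) /= eqxx big1 ?addr0 ?subrr // => h.
by move=> /negPf ->.
Qed.

Definition gid M : ghom M M :=
  @ghom_of M M id (fun a x y => erefl) (fun g x gx => gx).

Lemma gcomp_linear M N L (f : ghom N L) (h : ghom M N) : linear (f \o h).
Proof. by move=> a x y /=; rewrite !linearP. Qed.

Definition gcomp M N L (f : ghom N L) (h : ghom M N) : ghom M L :=
  ghom_of (gcomp_linear f h) (fun g x gx => ghom_deg f (ghom_deg h gx)).

Lemma gsub_linear M N (f h : ghom M N) : linear (f \- h).
Proof. by move=> a x y /=; rewrite !linearP scalerDr addrACA. Qed.

Definition gsub M N (f h : ghom M N) : ghom M N :=
  ghom_of (gsub_linear f h) (fun g x gx => grB (ghom_deg f gx) (ghom_deg h gx)).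

Lemma gzero_linear M N : linear (fun _ : M => 0 : N).
Proof. by move=> a x y; rewrite scaler0 addr0. Qed.

Definition gzero M N : ghom M N :=
  ghom_of (@gzero_linear M N) (fun g x gx => @gr0 _ _ _ _ N g).

(** * Kernels of graded maps *)

Section Kernel.
Variables (M N : gmod) (f : ghom M N).

Definition kerp : pred M := fun x => f x == 0.

Lemma kerp_submod_closed : GRing.submod_closed kerp.
Proof.
split=> [|a x y]; first by rewrite unfold_in /kerp linear0.
by rewrite !unfold_in /kerp linearP => /eqP-> /eqP->; rewrite scaler0 addr0.
Qed.

HB.instance Definition _ := GRing.isSubmodClosed.Build S M kerp kerp_submod_closed.

Definition kertype : Type := {x : M | x \in kerp}.
HB.instance Definition _ := [isSub of kertype for @sval M _].
HB.instance Definition _ := [Choice of kertype by <:].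
HB.instance Definition _ := [SubChoice_isSubLmodule of kertype by <:].

Definition ker_gr g : set kertype := [set x | gr g (val x)].

Lemma ker_gr0 g : ker_gr g 0. Proof. exact: gr0. Qed.

Lemma ker_grB g x y : ker_gr g x -> ker_gr g y -> ker_gr g (x - y).
Proof. exact: grB. Qed.

Lemma ker_grZ d e a x : homogS w d a -> ker_gr e x -> ker_gr (d + e) (a *: x).
Proof. exact: grZ. Qed.

(** The components of a kernel element lie in the kernel: their images are homogeneous of distinct
    degrees and sum to zero. *)
Lemma ker_gr_span (x : kertype) : exists s : seq kertype,
  (forall y, y \in s -> exists g, ker_gr g y) /\ x = \sum_(y <- s) y.
Proof.
have [s [c [us _ hc xs]]] := gr_decomp 0 (val x).
have fc g : g \in s -> f (c g) = 0.
  apply: (@gr_direct _ _ _ _ N s (fun g => f (c g)) us).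
    by move=> h; apply: ghom_deg.
  by rewrite -linear_sum -xs; apply/eqP; exact: (valP x).
have /choice[k hk] : forall g, exists k : kertype,
    val k = if g \in s then c g else 0.
  move=> g; case: ifP => [gs|_]; last by exists 0.
  have kg : c g \in kerp by rewrite unfold_in /kerp fc.
  by exists (Sub (c g) kg).
exists [seq k g | g <- s]; split.
  move=> _ /mapP[g gs ->]; exists g.
  by have := hc g; rewrite -[c g]/(if true then c g else 0) -gs -hk.
rewrite big_map; apply: val_inj; rewrite raddf_sum xs.
by apply: eq_big_seq => g gs; have := hk g; rewrite gs => <-.
Qed.

Lemma ker_gr_direct (s : seq G) (c : G -> kertype) : uniq s ->
  (forall g, ker_gr g (c g)) -> \sum_(g <- s) c g = 0 ->
  forall g, g \in s -> c g = 0.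
Proof.
move=> us hc s0 g gs; apply: val_inj.
apply: (@gr_direct _ _ _ _ M s (fun h => val (c h)) us _ _ g gs) => //.
by have := congr1 val s0; rewrite raddf_sum.
Qed.

Definition gker : gmod :=
  @GMod K G n w kertype ker_gr ker_gr0 ker_grB ker_grZ ker_gr_span ker_gr_direct.

Lemma gker_incl_linear : linear (fun x : gker => val (x : kertype) : M).
Proof. by []. Qed.

Definition gker_incl : ghom gker M := ghom_of gker_incl_linear (fun g x gx => gx).

Lemma gker_incl_inj : injective gker_incl.
Proof. exact: val_inj. Qed.

Lemma gker_inclP (x : gker) : f (gker_incl x) = 0.
Proof. by apply/eqP; exact: (valP (x : kertype)). Qed.

Lemma gker_elt x : f x = 0 -> exists y : gker, gker_incl y = x.
Proof.
move=> fx; have px : x \in kerp by rewrite unfold_in /kerp fx eqxx.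
by exists (Sub x px : kertype).
Qed.

Section Corestriction.
Variables (L : gmod) (h : ghom L M) (fh : forall x, f (h x) = 0).

Definition gcores_fun (x : L) : gker :=
  Sub (h x) (introT eqP (fh x) : h x \in kerp) : kertype.

Lemma gcores_linear : linear gcores_fun.
Proof. by move=> a x y; apply: val_inj; rewrite /= linearP. Qed.

Definition gcores : ghom L gker :=
  ghom_of gcores_linear (fun g x gx => ghom_deg h gx).

Lemma gcoresK x : gker_incl (gcores x) = h x.
Proof. by []. Qed.

End Corestriction.
End Kernel.

(** * Binary direct sums *)

Section BinarySum.
Variables M N : gmod.
Local Notation T := (M * N)%type.

Definition sum_gr g : set T := [set x | gr g x.1 /\ gr g x.2].

Lemma sum_gr0 g : sum_gr g 0. Proof. by split; exact: gr0. Qed.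

Lemma sum_grB g x y : sum_gr g x -> sum_gr g y -> sum_gr g (x - y).
Proof. by move=> [x1 x2] [y1 y2]; split; exact: grB. Qed.

Lemma sum_grZ d e a x : homogS w d a -> sum_gr e x -> sum_gr (d + e) (a *: x).
Proof. by move=> da [x1 x2]; split; exact: grZ. Qed.

Lemma sum_gr_span (x : T) : exists s : seq T,
  (forall y, y \in s -> exists g, sum_gr g y) /\ x = \sum_(y <- s) y.
Proof.
case: x => a b; have [s [hs ->]] := gr_span a; have [t [ht ->]] := gr_span b.
exists ([seq (y, 0) | y <- s] ++ [seq (0, y) | y <- t]); split.
  move=> y; rewrite mem_cat => /orP[] /mapP[z].
    by move=> /hs[g gz] ->; exists g; split=> //; exact: gr0.
  by move=> /ht[g gz] ->; exists g; split=> //; exact: gr0.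
rewrite big_cat !big_map.
rewrite [RHS]surjective_pairing !raddfD !raddf_sum /=.
by rewrite [X in (_ + X, _)]big1 // [X in (_, X + _)]big1 // addr0 add0r.
Qed.

Lemma sum_gr_direct (s : seq G) (c : G -> T) : uniq s ->
  (forall g, sum_gr g (c g)) -> \sum_(g <- s) c g = 0 ->
  forall g, g \in s -> c g = 0.
Proof.
move=> us hc s0 g gs; rewrite [c g]surjective_pairing.
rewrite (@gr_direct _ _ _ _ M s (fun h => (c h).1) us _ _ g gs) //.
- rewrite (@gr_direct _ _ _ _ N s (fun h => (c h).2) us _ _ g gs) //.
    by move=> h; case: (hc h).
  by have := congr1 snd s0; rewrite raddf_sum.
- by move=> h; case: (hc h).
- by have := congr1 fst s0; rewrite raddf_sum.
Qed.

Definition gsum : gmod :=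
  @GMod K G n w T sum_gr sum_gr0 sum_grB sum_grZ sum_gr_span sum_gr_direct.

End BinarySum.

End GradedModules.

(** Used to build families of graded maps degree by degree: [R] is the commutation or homotopy
    relation between neighbours, [P] the invariant under which the next map exists. *)
Lemma nat_dep_choice (T : nat -> Type) (P : forall k, T k -> Prop)
    (P0 : T 0 -> Prop) (R : forall k, T k -> T k.+1 -> Prop) :
  (exists2 x, P0 x & P 0 x) ->
  (forall k x, P k x -> exists2 y, R k x y & P k.+1 y) ->
  exists f : forall k, T k, P0 (f 0) /\ forall k, R k (f k) (f k.+1).
Proof.
move=> /cid2[x0 P0x0 Px0] step.
pose next k (x : {x | P k x}) : {x | P k.+1 x} :=
  let: exist2 y _ Py := cid2 (step k (sval x) (svalP x)) in exist _ y Py.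
pose F := nat_rect (fun k => {x | P k x}) (exist _ x0 Px0) next.
exists (fun k => sval (F k)); split=> // k.
by rewrite /= /next; case: cid2.
Qed.

(** * Extension of maps and comparison of injective resolutions *)

Section Homological.
Variables (K : fieldType) (G : zmodType) (n : nat) (w : 'I_n -> G).
Local Notation S := {mpoly K[n]}.
Local Notation gmod := (gmod K w).
Implicit Types (M N L Q : gmod) (g p : G).

(** A preimage need not be homogeneous, but its component of degree [g] maps to that of [y], which
    is [y] itself. *)
Lemma surj_gr_lift M N (f : ghom M N) : (forall y, exists x, f x = y) ->
  forall g y, gr g y -> exists2 x, gr g x & f x = y.
Proof.
move=> fs g y gy; have [x fx] := fs y.
have [s [c [us gs hc xs]]] := gr_decomp g x.
exists (c g) => //.
apply: (@gr_sum_comp _ _ _ _ N s (fun h => f (c h))) => //.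
  by move=> h; exact: ghom_deg.
by rewrite -fx xs linear_sum.
Qed.

(** The value of [h] does not depend on the chosen preimage. This gives linearity, and comparing
    with a homogeneous preimage gives preservation of degrees. *)
Lemma surj_factor M N L (f : ghom M N) (h : ghom M L) :
  (forall y, exists x, f x = y) -> (forall x, f x = 0 -> h x = 0) ->
  exists k : ghom N L, forall x, k (f x) = h x.
Proof.
move=> fs fh; have [s hs] := choice fs.
have E x y : f x = y -> h (s y) = h x.
  move=> fxy; apply/eqP; rewrite -subr_eq0 -linearB; apply/eqP/fh.
  by rewrite linearB hs fxy subrr.
have lin : linear (fun y => h (s y)).
  move=> a x y; rewrite -linearP; apply: E.
  by rewrite linearP !hs.
have deg g y : gr g y -> gr g (h (s y)).
  by move=> /(surj_gr_lift fs)[x gx /E->]; exact: ghom_deg.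
by exists (ghom_of lin deg) => x; exact: E.
Qed.

(* f : X -> Y factors through its image, which exactness at Y identifies with
   the graded submodule ker e of Y. *)
Lemma ginjective_extend (X Y Z Q : gmod) (f : ghom X Y) (e : ghom Y Z)
    (h : ghom X Q) : ginjective Q -> (forall y, e y = 0 <-> exists x, f x = y) ->
  (forall x, f x = 0 -> h x = 0) -> exists k : ghom Y Q, forall x, k (f x) = h x.
Proof.
move=> injQ exY fh.
have ef x : e (f x) = 0 by apply/exY; exists x.
pose f' := gcores ef.
have f's y : exists x, f' x = y.
  have [x fx] := (exY _).1 (gker_inclP y).
  by exists x; apply: gker_incl_inj; rewrite gcoresK.
have [x /(congr1 (@gker_incl _ _ _ _ _ _ _))|k hk] := surj_factor f's (h := h).
  by rewrite gcoresK linear0; exact: fh.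
have [k' hk'] := injQ _ _ _ k (@gker_incl_inj _ _ _ _ _ _ e).
by exists k' => x; rewrite -hk -hk' gcoresK.
Qed.

Section Complex.
Variables (M : gmod) (I : injres M).

Lemma ir_d_aug x : ir_d I 0 (ir_aug I x) = 0.
Proof. by apply/ir_exact0; exists x. Qed.

Lemma ir_dd k x : ir_d I k.+1 (ir_d I k x) = 0.
Proof. by apply/ir_exact; exists x. Qed.

End Complex.

Section Comparison.
Variables (M N : gmod) (f : ghom M N) (I : injres M) (I' : injres N).

(** The invariant is that [phi k] sends cocycles to cocycles; then [ir_d I' k] after [phi k] kills
    the kernel of [ir_d I k] and extends along it. *)
Lemma ir_lift : exists phi : forall k, ghom (ir_mod I k) (ir_mod I' k),
  (forall x, phi 0%N (ir_aug I x) = ir_aug I' (f x)) /\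
  forall k x, phi k.+1 (ir_d I k x) = ir_d I' k (phi k x).
Proof.
apply: (nat_dep_choice
  (T := fun k => ghom (ir_mod I k) (ir_mod I' k))
  (P := fun k phi => forall x, ir_d I k x = 0 -> ir_d I' k (phi x) = 0)
  (P0 := fun phi => forall x, phi (ir_aug I x) = ir_aug I' (f x))
  (R := fun k phi phi' => forall x, phi' (ir_d I k x) = ir_d I' k (phi x))).
- have [|phi hphi] := @ginjective_extend _ _ _ _ (ir_aug I)
    (ir_d I 0) (gcomp (ir_aug I') f) (@ir_inj _ _ _ _ _ I' 0)
    (@ir_exact0 _ _ _ _ _ I).
    move=> x; rewrite -(linear0 (ir_aug I)) => /(@ir_aug_inj _ _ _ _ _ I)->.
    by rewrite linear0.
  exists phi; first exact: hphi.
  by move=> x /ir_exact0[y <-]; rewrite hphi ir_d_aug.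
- move=> k phi hphi.
  have [x dx|phi' hphi'] := @ginjective_extend _ _ _ _ (ir_d I k)
    (ir_d I k.+1) (gcomp (ir_d I' k) phi) (@ir_inj _ _ _ _ _ I' k.+1)
    (@ir_exact _ _ _ _ _ I k).
    exact: hphi.
  exists phi'; first exact: hphi'.
  by move=> x /ir_exact[y <-]; rewrite hphi' ir_dd.
Qed.

(** By the invariant, [chi k.+1] minus the composite of [ir_d I' k] with [h k] vanishes on the image
    of [ir_d I k], which is the kernel of [ir_d I k.+1]; so it extends along the latter to
    [h k.+1]. *)
Lemma ir_homotopy (chi : forall k, ghom (ir_mod I k) (ir_mod I' k)) :
  (forall x, chi 0%N (ir_aug I x) = 0) ->
  (forall k x, chi k.+1 (ir_d I k x) = ir_d I' k (chi k x)) ->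
  exists h : forall k, ghom (ir_mod I k.+1) (ir_mod I' k),
    (forall x, chi 0%N x = h 0%N (ir_d I 0 x)) /\
    forall k x, chi k.+1 x = h k.+1 (ir_d I k.+1 x) + ir_d I' k (h k x).
Proof.
move=> chi0 chiS.
apply: (nat_dep_choice
  (T := fun k => ghom (ir_mod I k.+1) (ir_mod I' k))
  (P := fun k h => forall x,
     ir_d I' k (chi k x) = ir_d I' k (h (ir_d I k x)))
  (P0 := fun h => forall x, chi 0%N x = h (ir_d I 0 x))
  (R := fun k h h' => forall x,
     chi k.+1 x = h' (ir_d I k.+1 x) + ir_d I' k (h x))).
- have [|h hh] := @ginjective_extend _ _ _ _ (ir_d I 0)
    (ir_d I 1) (chi 0%N) (@ir_inj _ _ _ _ _ I' 0) (@ir_exact _ _ _ _ _ I 0).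
    by move=> x /ir_exact0[y <-]; exact: chi0.
  by exists h => x; rewrite hh.
- move=> k h hh.
  have [|h' hh'] := @ginjective_extend _ _ _ _ (ir_d I k.+1)
    (ir_d I k.+2) (gsub (chi k.+1) (gcomp (ir_d I' k) h)) (@ir_inj _ _ _ _ _ I' k.+1)
    (@ir_exact _ _ _ _ _ I k.+1).
    by move=> x /ir_exact[y <-]; rewrite /= chiS hh subrr.
  exists h' => x; first by rewrite hh' /= subrK.
  by rewrite hh' /= linearB ir_dd subr0.
Qed.

End Comparison.

(** * Torsion, and independence of the resolution *)

Section Torsion.
Variable B : set S.

Lemma ideal_powM t (a f : S) : ideal_pow B t f -> ideal_pow B t (a * f).
Proof.
elim: t a f => [//|t IH] a f [s [hs ->]].
exists [seq (u.1, a * u.2) | u <- s]; split.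
  by move=> _ /mapP[u /hs[u1 u2] ->]; split=> //; exact: IH.
by rewrite big_map mulr_sumr; apply: eq_bigr => u _; rewrite mulrCA.
Qed.

Lemma ideal_powD t (a f : S) :
  ideal_pow B t a -> ideal_pow B t f -> ideal_pow B t (a + f).
Proof.
case: t => [//|t] [s [hs ->]] [s' [hs' ->]]; exists (s ++ s').
by rewrite big_cat; split=> // u; rewrite mem_cat => /orP[/hs|/hs'].
Qed.

Lemma ideal_pow0 t : ideal_pow B t 0.
Proof. by case: t => [//|t]; exists [::]; rewrite big_nil. Qed.

Lemma ideal_pow_le t t' (f : S) : (t <= t')%N ->
  ideal_pow B t' f -> ideal_pow B t f.
Proof.
move=> /subnK <-; elim: (t' - t)%N f => [//|r IH] f.
move=> [s [hs ->]]; elim: s hs => [|u s IHs] hs.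
  by rewrite big_nil; exact: ideal_pow0.
rewrite big_cons; apply: ideal_powD.
  by apply/ideal_powM/IH; case: (hs u (mem_head _ _)).
by apply: IHs => v vs; apply: hs; rewrite inE vs orbT.
Qed.

Lemma torsion0 M : @torsion _ _ _ _ B M 0.
Proof. by exists 0%N => f _; rewrite scaler0. Qed.

Lemma torsionN M (x : M) : torsion B x -> torsion B (- x).
Proof.
by move=> [t ht]; exists t => f /ht; rewrite scalerN => ->; rewrite oppr0.
Qed.

Lemma torsionD M (x y : M) : torsion B x -> torsion B y -> torsion B (x + y).
Proof.
move=> [t ht] [t' ht']; exists (maxn t t') => f hf.
rewrite scalerDr ht ?ht' ?addr0 //.
  exact: ideal_pow_le (leq_maxr _ _) hf.
exact: ideal_pow_le (leq_maxl _ _) hf.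
Qed.

Lemma torsion_hom M N (f : ghom M N) x : torsion B x -> torsion B (f x).
Proof.
by move=> [t ht]; exists t => a /ht; rewrite -linearZ => ->; rewrite linear0.
Qed.

(** Only the inclusion with content is kept: coboundaries are cocycles in every resolution. *)
Definition lc_vanishes M (I : injres M) i p :=
  @lc_cocycles _ _ _ _ B M I i p `<=` @lc_coboundaries _ _ _ _ B M I i p.

Lemma lc_zeroP i M p : lc_zero B i M p <-> exists I : injres M, lc_vanishes I i p.
Proof.
split=> -[I]; [by move=> eqI; exists I; rewrite /lc_vanishes eqI|move=> vI].
exists I; apply/seteqP; split=> //.
case: i {vI} => [_ ->|i _ [y [ty gy] <-]].
  by split; [exact: torsion0|exact: gr0|exact: linear0].
by split; [exact: torsion_hom|exact: ghom_deg|exact: ir_dd].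
Qed.

(** Lifts [f], [g] of the identity in both directions make the identity of [I'] homotopic to [f]
    after [g]. For a cocycle [z] of [I'], [g z] bounds in [I], hence so do [f (g z)] and [z] in
    [I']; graded maps preserve torsion and degree. *)
Lemma lc_vanishes_indep M (I I' : injres M) i p :
  lc_vanishes I i p -> lc_vanishes I' i p.
Proof.
move=> vI z [tz gz dz].
have [f [f0 fS]] := ir_lift (gid M) I I'.
have [g [g0 gS]] := ir_lift (gid M) I' I.
have [x||h [h0 hS]] := ir_homotopy (I := I') (I' := I')
  (chi := fun k => gsub (gid _) (gcomp (f k) (g k))).
- by rewrite /= g0 f0 subrr.
- by move=> k x; rewrite /= gS fS linearB.
have cz : @lc_cocycles _ _ _ _ B M I i p (g i z).
  by split; [exact: torsion_hom|exact: ghom_deg|rewrite -gS dz linear0].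
case: i z tz gz dz cz vI => [|i] z tz gz dz cz vI.
  have := vI _ cz; rewrite /= => gz0.
  by have := h0 z; rewrite /= dz gz0 !linear0 addr0.
have [y [ty gy] dy] := vI _ cz.
exists (f i y + h i z); first split.
- by apply: torsionD; apply: torsion_hom.
- by apply: grD; apply: ghom_deg.
have := hS i z; rewrite /= dz linear0 add0r => hz.
by rewrite linearD -hz -fS dy addrC subrK.
Qed.

End Torsion.
End Homological.

(** * Local cohomology of finite sums of shifts *)

Section ShiftSums.
Variables (K : fieldType) (G : zmodType) (n : nat) (w : 'I_n -> G).
Local Notation S := {mpoly K[n]}.
Local Notation gmod := (gmod K w).
Implicit Types (M N L Q : gmod) (g p : G).

Section Maps.
Variables (I : finType) (d : I -> G).

Section Map.
Variables (M N : gmod) (f : ghom M N).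

Definition shift_sum_fun (F : shift_sum M d) : shift_sum N d :=
  [ffun i => f ((F : {ffun I -> M}) i)].

Lemma shift_sum_fun_linear : linear shift_sum_fun.
Proof. by move=> a x y; apply/ffunP => i; rewrite !ffunE linearP. Qed.

Lemma shift_sum_fun_deg g x : gr g x -> gr g (shift_sum_fun x).
Proof. by move=> gx i; rewrite ffunE; apply: ghom_deg; exact: gx. Qed.

Definition shift_sum_map : ghom (shift_sum M d) (shift_sum N d) :=
  ghom_of shift_sum_fun_linear shift_sum_fun_deg.

End Map.

Lemma shift_sum_mapE M N (f : ghom M N) (F : {ffun I -> M}) i :
  (shift_sum_map f F : {ffun I -> N}) i = f (F i).
Proof. by rewrite /= ffunE. Qed.

Lemma shift_sum_map_inj M N (f : ghom M N) :
  injective f -> injective (shift_sum_map f).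
Proof.
move=> fi F F' FF; apply/ffunP => i; apply: fi.
by rewrite -!shift_sum_mapE FF.
Qed.

Lemma shift_sum_map_exact M N L (f : ghom M N) (h : ghom N L) :
  (forall y, h y = 0 <-> exists x, f x = y) ->
  forall y, shift_sum_map h y = 0 <-> exists x, shift_sum_map f x = y.
Proof.
move=> ex y; split=> [hy|[x <-]]; last first.
  apply/ffunP => i; rewrite !shift_sum_mapE ffunE; apply/ex.
  by exists ((x : {ffun I -> M}) i).
have /choice[x hx] : forall i, exists x, f x = (y : {ffun I -> N}) i.
  by move=> i; apply/ex; rewrite -shift_sum_mapE hy ffunE.
by exists [ffun i => x i]; apply/ffunP => i; rewrite shift_sum_mapE ffunE.
Qed.

Lemma shift_ghom M N (f : ghom M N) g :
  exists f' : ghom (shift M g) (shift N g), forall x, f' x = f x.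
Proof.
exists (@ghom_of K G n w (shift M g) (shift N g) f (@linearP _ _ _ _ f)
  (fun h x hx => ghom_deg f hx)).
by [].
Qed.

(** A degree-preserving map from [A] to the [i]-th summand is one from [A] shifted by [- d i] to
    [Q]; so each coordinate of [v] extends separately. *)
Lemma shift_sum_ginjective Q : ginjective Q -> ginjective (shift_sum Q d).
Proof.
move=> injQ A C u v ui.
have ext i : exists h : C -> Q, [/\ linear h,
    forall g x, gr g x -> gr (d i + g) (h x)
  & forall x, h (u x) = (v x : {ffun I -> Q}) i].
  have deg_v g x : @gr _ _ _ _ (shift A (- d i)) g x ->
      gr g ((v x : {ffun I -> Q}) i).
    move=> /(ghom_deg v) /(_ i); rewrite /= /shift_gr /mkset.
    by rewrite addrA subrr add0r.
  have lin_v : linear (fun x : shift A (- d i) => (v x : {ffun I -> Q}) i).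
    by move=> a x y; rewrite linearP !ffunE.
  have [u' hu'] := shift_ghom u (- d i).
  have u'i : injective u' by move=> x y; rewrite !hu'; exact: ui.
  have [h hh] := injQ _ _ u' (ghom_of lin_v deg_v) u'i.
  exists h; split; first exact: (@linearP _ _ _ _ h).
    move=> g x gx; apply: ghom_deg; rewrite /= /shift_gr /mkset.
    by rewrite addrA addNr add0r.
  by move=> x; rewrite -hu' hh.
have [h hh] := choice ext.
have lin : linear (fun x : C => [ffun i => h i x] : shift_sum Q d).
  move=> a x y; apply/ffunP => i; rewrite !ffunE.
  by have [-> _ _] := hh i.
have deg g x : gr g x -> @gr _ _ _ _ (shift_sum Q d) g [ffun i => h i x].
  by move=> gx i; rewrite ffunE; have [_ + _] := hh i; apply.
exists (ghom_of lin deg) => x; apply/ffunP => i; rewrite ffunE.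
by have [_ _ ->] := hh i.
Qed.

Definition shift_sum_injres M (I0 : injres M) : injres (shift_sum M d) :=
  @InjRes _ _ _ _ (shift_sum M d) (fun k => shift_sum (ir_mod I0 k) d)
    (shift_sum_map (ir_aug I0)) (fun k => shift_sum_map (ir_d I0 k))
    (fun k => shift_sum_ginjective (@ir_inj _ _ _ _ _ I0 k))
    (shift_sum_map_inj (@ir_aug_inj _ _ _ _ _ I0))
    (shift_sum_map_exact (@ir_exact0 _ _ _ _ _ I0))
    (fun k => shift_sum_map_exact (@ir_exact _ _ _ _ _ I0 k)).

Lemma torsion_shift_sum (B : set S) M (F : shift_sum M d) :
  (forall i, torsion B ((F : {ffun I -> M}) i)) <-> torsion B F.
Proof.
split=> [/choice[t ht]|[t ht] i]; last first.
  by exists t => a /ht /(congr1 (fun H : {ffun I -> M} => H i)); rewrite !ffunE.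
(* As [I] is finite, the largest exponent serves for all coordinates. *)
exists (\max_i t i)%N => a ha; apply/ffunP => i; rewrite !ffunE.
by apply: ht; apply: ideal_pow_le ha; exact: leq_bigmax.
Qed.

Lemma lc_vanishes_shift_sum (B : set S) M (I0 : injres M) k p :
  (forall i, lc_vanishes B I0 k (d i + p)) ->
  lc_vanishes B (shift_sum_injres I0) k p.
Proof.
move=> van z [/torsion_shift_sum tz gz dz].
have cz i : @lc_cocycles _ _ _ _ B M I0 k (d i + p)
    ((z : {ffun I -> ir_mod I0 k}) i).
  by split; [exact: tz|exact: gz|rewrite -shift_sum_mapE dz ffunE].
case: k z tz gz dz cz van => [|k] z tz gz dz cz van.
  by apply/ffunP => i; rewrite ffunE; exact: (van i _ (cz i)).
have /choice[y hy] : forall i, exists y, [/\ torsion B y, gr (d i + p) y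
    & ir_d I0 k y = (z : {ffun I -> ir_mod I0 k.+1}) i].
  by move=> i; have [y [ty gy] dy] := van i _ (cz i); exists y.
exists [ffun i => y i]; first split.
- by apply/torsion_shift_sum => i; rewrite ffunE; case: (hy i).
- by move=> i; rewrite ffunE; case: (hy i).
- by apply/ffunP => i; rewrite shift_sum_mapE ffunE; case: (hy i).
Qed.

End Maps.

(** A zero module is injective, and repeating it in every degree gives an injective resolution. *)
Lemma lc_zero_trivial (B : set S) M i p : (forall x : M, x = 0) -> lc_zero B i M p.
Proof.
move=> M0; have injM : ginjective M.
  by move=> A C u v _; exists (gzero C M) => x; rewrite [RHS]M0.
pose I := @InjRes _ _ _ _ M (fun=> M) (gid M) (fun=> gid M) (fun=> injM)
  (fun x y e => e)
  (fun x => conj (fun _ => ex_intro _ x erefl) (fun _ => M0 _))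
  (fun _ x => conj (fun _ => ex_intro _ x erefl) (fun _ => M0 _)).
apply/lc_zeroP; exists I => z _; case: i z => [|i] z; first exact: M0.
by exists 0; [split; [exact: torsion0|exact: gr0]|rewrite linear0 [RHS]M0].
Qed.

End ShiftSums.

(** * The cone resolution of a cokernel, and induction along a resolution *)

Section Cone.
Variables (K : fieldType) (G : zmodType) (n : nat) (w : 'I_n -> G).
Local Notation S := {mpoly K[n]}.
Local Notation gmod := (gmod K w).
Implicit Types (M N L Q : gmod) (g p : G).

Lemma ginjective_sum Q L : ginjective Q -> ginjective L -> ginjective (gsum Q L).
Proof.
move=> injQ injL A C u v ui.
have lin1 : linear (fun x : gsum Q L => x.1 : Q) by [].
have lin2 : linear (fun x : gsum Q L => x.2 : L) by [].
have [h hh] := injQ _ _ u (gcomp (ghom_of lin1 (fun _ _ gx => gx.1)) v) ui.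
have [k hk] := injL _ _ u (gcomp (ghom_of lin2 (fun _ _ gx => gx.2)) v) ui.
have lin : linear (fun x : C => (h x, k x) : gsum Q L).
  by move=> a x y; rewrite !linearP.
exists (ghom_of lin (fun g x gx => conj (ghom_deg h gx) (ghom_deg k gx))) => x.
by rewrite /= hh hk -surjective_pairing.
Qed.

Lemma ginjective_retract Q L (e : ghom L Q) (r : ghom Q L) :
  (forall x, r (e x) = x) -> ginjective Q -> ginjective L.
Proof.
move=> re injQ A C u v ui; have [h hh] := injQ _ _ u (gcomp e v) ui.
by exists (gcomp r h) => x; rewrite /= hh /= re.
Qed.

Section ConeResolution.
Variables (M N : gmod) (f : ghom N M).
Hypothesis f_surj : forall y, exists x, f x = y.
Variables (IN : injres N) (IA : injres (gker f)).
Variable phi : forall k, ghom (ir_mod IA k) (ir_mod IN k).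
Hypothesis phi_aug : forall x, phi 0%N (ir_aug IA x) = ir_aug IN (gker_incl _ x).
Hypothesis phi_d : forall k x, phi k.+1 (ir_d IA k x) = ir_d IN k (phi k x).

(** The mapping cone of [phi] in degrees at least 0. Its term in degree -1 is [ir_mod IA 0] alone,
    with differential [cone_in]. *)
Definition cone k : gmod := gsum (ir_mod IN k) (ir_mod IA k.+1).

Definition cone_d_fun k (x : cone k) : cone k.+1 :=
  (ir_d IN k x.1 + phi k.+1 x.2, - ir_d IA k.+1 x.2).

Lemma cone_d_linear k : linear (@cone_d_fun k).
Proof.
move=> a x y; apply: injective_projections; rewrite /= !linearP //.
by rewrite scalerDr addrACA.
Qed.

Lemma cone_d_deg k g x : gr g x -> gr g (@cone_d_fun k x).
Proof.
move=> [g1 g2]; split; first by apply: grD; exact: ghom_deg.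
by apply: grN; exact: ghom_deg.
Qed.

Definition cone_d k : ghom (cone k) (cone k.+1) :=
  ghom_of (@cone_d_linear k) (@cone_d_deg k).

Definition cone_in_fun (x : ir_mod IA 0) : cone 0 := (phi 0%N x, - ir_d IA 0 x).

Lemma cone_in_linear : linear cone_in_fun.
Proof. by move=> a x y; apply: injective_projections; rewrite /= !linearP. Qed.

Definition cone_in : ghom (ir_mod IA 0) (cone 0) :=
  ghom_of cone_in_linear
    (fun g x gx => conj (ghom_deg (phi 0%N) gx) (grN (ghom_deg (ir_d IA 0) gx))).

Definition cone_aug_fun (x : N) : cone 0 := (ir_aug IN x, 0).

Lemma cone_aug_linear : linear cone_aug_fun.
Proof.
by move=> a x y; apply: injective_projections; rewrite /= ?linearP // scaler0 addr0.
Qed.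

Definition cone_aug : ghom N (cone 0) :=
  ghom_of cone_aug_linear
    (fun g x gx => conj (ghom_deg (ir_aug IN) gx) (@gr0 _ _ _ _ _ g)).

(** This controls the overlap of the images of [cone_in] and [cone_aug]; both [cone_in] and the
    augmentation of [M] are injective because of it. *)
Lemma cone_inP x y : cone_in x = (y, 0) ->
  exists a : gker f, ir_aug IA a = x /\ ir_aug IN (gker_incl _ a) = y.
Proof.
move=> [px dx].
have [a ax] : exists a, ir_aug IA a = x.
  by apply/ir_exact0; apply/eqP; rewrite -oppr_eq0 dx.
by exists a; rewrite -phi_aug ax px.
Qed.

Lemma cone_in_inj : injective cone_in.
Proof.
apply: raddf_inj => x /cone_inP[a [<-]]; rewrite -(linear0 (ir_aug IN)).
move=> /(@ir_aug_inj _ _ _ _ _ IN); rewrite -(linear0 (gker_incl f)).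
by move=> /gker_incl_inj ->; rewrite linear0.
Qed.

Lemma cone_d_in x : cone_d 0 (cone_in x) = 0.
Proof.
apply: injective_projections; rewrite /= linearN.
  by rewrite phi_d subrr.
by rewrite ir_dd !oppr0.
Qed.

Lemma cone_d_aug x : cone_d 0 (cone_aug x) = 0.
Proof.
by apply: injective_projections; rewrite /= linear0 ?oppr0 // ir_d_aug addr0.
Qed.

Lemma cone_dd k x : cone_d k.+1 (cone_d k x) = 0.
Proof.
apply: injective_projections; rewrite /= linearN.
  by rewrite linearD ir_dd phi_d add0r subrr.
by rewrite ir_dd !oppr0.
Qed.

(** Adding to [z] the cone differential of [(0, a)], which is [cone_in a] for [k = 0], clears the
    second coordinate and leaves [z.1 + phi k a] in the first. *)
Lemma cone_cocycle_lift k (z : cone k) a : cone_d k z = 0 ->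
  ir_d IA k a = z.2 -> ir_d IN k (z.1 + phi k a) = 0.
Proof. by move=> [zz _] az; rewrite linearD -phi_d az zz. Qed.

Variable r : ghom (cone 0) (ir_mod IA 0).
Hypothesis r_in : forall x, r (cone_in x) = x.

Let proj_spec x : r (gsub (gid _) (gcomp cone_in r) x) = 0.
Proof. by rewrite /= linearB r_in subrr. Qed.

(* gker r stands for the quotient of cone 0 by the image of cone_in, with
   cone_proj as the quotient map. *)
Definition cone_proj : ghom (cone 0) (gker r) := gcores proj_spec.

Lemma cone_projE x : gker_incl _ (cone_proj x) = x - cone_in (r x).
Proof. by []. Qed.

Lemma cone_projK x : cone_proj (gker_incl _ x) = x.
Proof.
by apply: gker_incl_inj; rewrite cone_projE gker_inclP linear0 subr0.
Qed.

Lemma cone_proj_in x : cone_proj (cone_in x) = 0.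
Proof.
by apply: gker_incl_inj; rewrite cone_projE r_in subrr linear0.
Qed.

Lemma cone_d_proj x : cone_d 0 (gker_incl _ (cone_proj x)) = cone_d 0 x.
Proof. by rewrite cone_projE linearB cone_d_in subr0. Qed.

Lemma cone_proj_eq0 x : cone_proj x = 0 -> x = cone_in (r x).
Proof.
move=> /(congr1 (gker_incl r)).
by rewrite cone_projE linear0 => /eqP; rewrite subr_eq0 => /eqP.
Qed.

Definition cres_mod k : gmod := if k is j.+1 then cone j.+1 else gker r.

Definition cres_d k : ghom (cres_mod k) (cres_mod k.+1) :=
  match k with
  | 0 => gcomp (cone_d 0) (gker_incl r)
  | j.+1 => cone_d j.+1
  end.

Lemma cres_inj k : ginjective (cres_mod k).
Proof.
have injC j : ginjective (cone j) by apply: ginjective_sum; exact: ir_inj.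
case: k => [|k]; last exact: injC.
exact: ginjective_retract cone_projK (injC 0).
Qed.

Lemma cone_exact k (z : cone k.+1) : cone_d k.+1 z = 0 -> exists y, cone_d k y = z.
Proof.
move=> dz; have [_ /eqP] := dz; rewrite oppr_eq0 => /eqP/ir_exact[a az].
have /ir_exact[b bz] := cone_cocycle_lift dz az.
exists (b, - a); apply: injective_projections; rewrite /= linearN.
  by rewrite bz addrK.
by rewrite opprK.
Qed.

Lemma cres_exact k z : cres_d k.+1 z = 0 <-> exists y, cres_d k y = z.
Proof.
split=> [/cone_exact[y <-]|[y <-]]; last by case: k z y => *; exact: cone_dd.
case: k z y => [|k] z y; last by exists y.
by exists (cone_proj y); rewrite -cone_d_proj.
Qed.

(** On [ker f] the map [cone_aug] agrees with [cone_in] after [ir_aug IA], so it dies in [gker r];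
    hence [cone_proj] after [cone_aug] factors through [f]. *)
Lemma cres_augP : exists2 aug : ghom M (gker r), injective aug &
  forall z, cres_d 0 z = 0 <-> exists y, aug y = z.
Proof.
have [x fx|aug haug] :=
    @surj_factor _ _ _ _ _ _ _ f (gcomp cone_proj cone_aug) f_surj.
  have [a <-] := gker_elt fx; rewrite /=.
  rewrite -[RHS](cone_proj_in (ir_aug IA a)); congr (cone_proj _).
  by rewrite /= /cone_in_fun /cone_aug_fun phi_aug ir_d_aug oppr0.
exists aug.
  suff H y : aug y = 0 -> y = 0 by exact: raddf_inj H.
  have [x <-] := f_surj y; rewrite haug => /cone_proj_eq0/esym/cone_inP[a [_]].
  by move=> /(@ir_aug_inj _ _ _ _ _ IN) <-; exact: gker_inclP.
move=> z; split=> [dz|[y <-]]; last first.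
  have [x <-] := f_surj y; rewrite haug -(cone_d_aug x) -cone_d_proj.
  by [].
have {}dz : cone_d 0 (gker_incl r z) = 0 by [].
have [_ /eqP] := dz; rewrite oppr_eq0 => /eqP/ir_exact[a az].
have /ir_exact0[b bz] := cone_cocycle_lift dz az.
(* In [cone 0] the sum of [z] and [cone_in a] is [cone_aug b], and [cone_proj] kills [cone_in a]. *)
exists (f b); rewrite haug -[RHS]cone_projK -[RHS]addr0 -(cone_proj_in a).
rewrite -linearD; congr (cone_proj _).
by apply: injective_projections; rewrite /= ?az ?subrr.
Qed.

Definition cone_injres : injres M :=
  let: exist2 aug aug_inj aug_exact := cid2 cres_augP in
  @InjRes _ _ _ _ M cres_mod aug cres_d cres_inj aug_inj aug_exact cres_exact.

(** The chase of [cone_exact] is repeated with torsion elements of degree [p]: the hypothesis on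
    [IA] supplies [a], and then the one on [IN] makes [z.1 + phi k a] a coboundary. *)
Lemma cone_lc_vanishes (B : set S) i p : lc_vanishes B IN i p ->
  lc_vanishes B IA i.+1 p -> lc_vanishes B cone_injres i p.
Proof.
move=> vN vA; rewrite /lc_vanishes /cone_injres; case: cid2 => aug aug_inj aug_ex.
have cobound k (z : cone k) : lc_vanishes B IN k p ->
    lc_vanishes B IA k.+1 p -> torsion B z -> gr p z -> cone_d k z = 0 ->
    exists a : ir_mod IA k, [/\ torsion B a, gr p a, ir_d IA k a = z.2
      & @lc_coboundaries _ _ _ _ B N IN k p (z.1 + phi k a)].
  move=> {}vN {}vA tz [g1 g2] dz.
  have [t1 t2] : torsion B z.1 /\ torsion B z.2.
    by case: tz => t ht; split; exists t => a /ht zt;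
      [have := congr1 fst zt|have := congr1 snd zt].
  have [|a [ta ga] az] := vA z.2.
    by split=> //; case: dz => _ /eqP; rewrite oppr_eq0 => /eqP.
  exists a; split=> //; apply: vN; split.
  - by apply: torsionD => //; exact: torsion_hom.
  - by apply: grD => //; exact: ghom_deg.
  - exact: cone_cocycle_lift.
case: i vN vA => [|i] vN vA z [tz gz dz].
  have {}dz : cone_d 0 (gker_incl r z) = 0 by [].
  have [a [_ _ az bz]] := cobound 0%N (gker_incl r z) vN vA
    (torsion_hom (gker_incl r) tz) (ghom_deg (gker_incl r) gz) dz.
  (* In degree 0 the only coboundary of [IN] is 0, so [z] lies in the image of [cone_in], which is
     divided out. *)
  have zE : gker_incl r z = cone_in (- a).
    apply: injective_projections; rewrite /= !linearN ?az ?opprK //.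
    by apply/eqP; rewrite -addr_eq0; apply/eqP.
  by rewrite -[z]cone_projK zE cone_proj_in.
have {vN vA} [y [ty gy dy]] : exists y : cone i,
    [/\ torsion B y, gr p y & cone_d i y = z].
  have [a [ta ga az [b [tb gb] bz]]] := cobound _ z vN vA tz gz dz.
  exists (b, - a); split.
  - have [[t ht] [t' ht']] := (tb, torsionN ta).
    exists (maxn t t') => c hc; apply: injective_projections => /=.
      by apply: ht; exact: ideal_pow_le (leq_maxl _ _) hc.
    by apply: ht'; exact: ideal_pow_le (leq_maxr _ _) hc.
  - by split=> //; exact: grN.
  - apply: injective_projections; rewrite /= linearN; first by rewrite bz addrK.
    by rewrite az opprK.
(* For a cocycle in degree 1 the primitive [y] lies in [cone 0] and must be moved to [gker r];
   [cone_proj] does not change its differential. *)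
case: i z tz gz dz y ty gy dy => [|i] z tz gz dz y ty gy dy; last by exists y.
exists (cone_proj y); last by rewrite -[RHS]dy -cone_d_proj.
by split; [exact: torsion_hom|exact: ghom_deg].
Qed.

End ConeResolution.

Lemma lc_zero_cokernel (B : set S) M N (f : ghom N M) i p :
  (forall y, exists x, f x = y) ->
  lc_zero B i N p -> lc_zero B i.+1 (gker f) p -> lc_zero B i M p.
Proof.
move=> fs /lc_zeroP[IN vN] /lc_zeroP[IA vA].
have [phi [phi0 phiS]] := ir_lift (gker_incl f) IA IN.
(* Extending the identity of the injective module [ir_mod IA 0] along [cone_in] gives the
   retraction. *)
have [r hr] := ir_inj (gid _) (cone_in_inj phi0).
apply/lc_zeroP; exists (cone_injres fs phi0 phiS hr).
exact: cone_lc_vanishes.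
Qed.

(** Induction on the length: the modules from [F 1] on resolve the kernel of [aug], and passing to
    that kernel raises the cohomological degree by one, so the sum [i + k] attached to each module
    is kept. *)
Lemma lc_zero_resolution (B : set S) (s : nat) (F : nat -> gmod) M
    (aug : ghom (F 0%N) M) (del : forall k, ghom (F k.+1) (F k)) i p :
  (forall k (x : F k), (s <= k)%N -> x = 0) ->
  (forall x, exists y, aug y = x) ->
  (forall y, aug y = 0 <-> exists z, del 0%N z = y) ->
  (forall k y, del k y = 0 <-> exists z, del k.+1 z = y) ->
  (forall k, lc_zero B (i + k)%N (F k) p) -> lc_zero B i M p.
Proof.
elim: s F M aug del i => [|s IH] F M aug del i F0 aug_surj ex0 ex vF.
  apply: lc_zero_trivial => x; have [y <-] := aug_surj x.
  by rewrite (F0 _ y) // linear0.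
apply: (lc_zero_cokernel aug_surj); first by have := vF 0%N; rewrite addn0.
have ad x : aug (del 0%N x) = 0 by apply/ex0; exists x.
apply: (IH (fun k => F k.+1) _ (gcores ad) (fun k => del k.+1)).
- by move=> k x sk; exact: F0.
- move=> x; have [y yx] := (ex0 _).1 (gker_inclP x).
  by exists y; apply: gker_incl_inj.
- move=> y; rewrite -ex; split=> [|dy].
    by move=> /(congr1 (gker_incl aug)); rewrite gcoresK linear0.
  by apply: gker_incl_inj; rewrite gcoresK linear0.
- by move=> k y; exact: ex.
- by move=> k; have := vF k.+1; rewrite addSnnS.
Qed.

End Cone.

Theorem lemma3p6 (K : fieldType) (G : zmodType) (hG : fin_gen_group G)
  (n : nat) (w : 'I_n -> G) (B : set {mpoly K[n]}) (hB : graded_ideal w B)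
  (s : nat) (J : s.+1.-tuple {fset G}) (V : nat -> set G)
  (hV : forall i : nat, (V i `<=` lc_zero B i (Smod K w))%classic)
  (M : gmod K w) (hM : has_resolution_of_type J M) :
  forall i : nat, (typeD V J i `<=` lc_zero B i M)%classic.
Proof.
move=> i q hq; have [mult [_ [aug [del [aug_surj ex0 ex]]]]] := hM.
have F0 k (x : free_of_type K w (nth fset0 J k) (mult k)) : (s < k)%N -> x = 0.
  move=> sk; apply/ffunP => -[[d dJ] ?].
  by have := dJ; rewrite [in X in X -> _]nth_default ?size_tuple.
apply: (lc_zero_resolution (s := s.+1) F0 aug_surj ex0 ex) => k.
have [sk|ks] := ltnP s k.
  by apply: lc_zero_trivial => x; exact: F0.
(* The degree [q] part of S(-d) is the degree [- d + q] part of S, and [q] lies in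
   [d + V (i + k)]. *)
have Vq d : d \in nth fset0 J k -> lc_zero B (i + k) (Smod K w) (- d + q).
  move=> dJ; have [|v Vv <-] := hq (inord k) I d.
    by rewrite /mkset (tnth_nth fset0) inordK.
  by rewrite addKr; apply: hV; move: Vv; rewrite inordK.
(* A resolution of S is obtained from [Vq] at some summand; a sum without summands is zero and is
   treated apart. *)
have [j0 _|noj] := pickP (@predT {d : nth fset0 J k & 'I_(mult k (val d))});
  last by apply: lc_zero_trivial => x; apply/ffunP => j; have := noj j.
have /lc_zeroP[I0 _] := Vq _ (valP (tag j0)).
apply/lc_zeroP; exists (shift_sum_injres _ I0).
apply: lc_vanishes_shift_sum => j.
(* The resolution [I1] may vary with [j]; independence transfers the vanishing to the common
   [I0]. *)
have /lc_zeroP[I1 v1] := Vq _ (valP (tag j)).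
exact: lc_vanishes_indep v1.
Qed.
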